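(* Let $f,g:\mathbb{R}^{d_x}\times\mathbb{R}^{d_y}\to\mathbb{R}$ satisfy the standing assumption (a)–(e) in the context, with the constants $\ell$ and $\kappa$ defined there. Then the hyper-objective $\varphi(x)=\min_{y\in Y^*(x)}f(x,y)$ has $O(\ell\kappa^3)$-Lipschitz gradients; that is, $\varphi$ is differentiable and there is a numerical constant $C>0$ with $\|\nabla\varphi(x_1)-\nabla\varphi(x_2)\|\le C\ell\kappa^3\|x_1-x_2\|$ for all $x_1,x_2\in\mathbb{R}^{d_x}$.
   Context: A function $h:\mathbb{R}^d\to\mathbb{R}$ is $\mu$-PL ($\mu>0$) if it has a non-empty set of minimizers and $\|\nabla h(x)\|^2\ge2\mu(h(x)-\min h)$ for all $x$. For $\sigma\ge0$ let $h_\sigma=\sigma f+g$, and let $Y^*(x)=\arg\min_{y\in\mathbb{R}^{d_y}}g(x,y)$. Standing assumption. There are $\overline\sigma>0$ and positive constants such that: (a) $h_\sigma(x,y)$ is $\mu$-PL in $y$ (for every $x$) for every $0\le\sigma\le\overline\sigma$; (b) $f$ is $C_f$-Lipschitz in $y$ and has $L_f$-Lipschitz gradients; (c) $g$ has $L_g$-Lipschitz gradients; (d) $\nabla^2_{xy}f$ and $\nabla^2_{yy}f$ exist and are $\rho_f$-Lipschitz; (e) $g$ is twice differentiable with $\rho_g$-Lipschitz Hessian. Put $\ell=\max\{C_f,L_f,L_g,\rho_g\}$ and $\kappa=\ell/\mu$. The $O(\cdot)$ bound is understood in the usual regime $\kappa\ge1$. *)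

(* Defs.v *)
From HB Require Import structures.
From mathcomp Require Import all_boot all_order all_algebra.
From mathcomp Require Import all_classical all_reals all_analysis.

Set Implicit Arguments.
Unset Strict Implicit.
Unset Printing Implicit Defensive.

Import Order.TTheory GRing.Theory Num.Theory.
Import numFieldNormedType.Exports.

Local Open Scope classical_set_scope.
Local Open Scope ring_scope.

(* The library norm on 'rV[R]_n is the max norm; since the final bound has a
   dimension-free constant, every Lipschitz condition below is instead stated
   with the Euclidean norm. Differentiability does not depend on the norm. *)
Definition enorm (R : realType) (n : nat) (v : 'rV[R]_n) : R :=
  Num.sqrt (\sum_(i < n) v ord0 i ^+ 2).

(* Operator norm for the Euclidean norms. Matrices act on row vectors on the
   right, as in the library's 'J; a matrix and its transpose have the same
   operator norm. *)
Definition opnorm (R : realType) (m n : nat) (A : 'M[R]_(m, n)) : R :=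
  sup [set enorm (v *m A) | v in [set v : 'rV[R]_m | enorm v <= 1]].

Definition grad (R : realType) (n : nat) (h : 'rV[R]_n -> R) (x : 'rV[R]_n) :
    'rV[R]_n :=
  \row_(i < n) 'D_(delta_mx ord0 i) h x.

Definition lipschitz_gradient (R : realType) (n : nat) (L : R)
    (h : 'rV[R]_n -> R) : Prop :=
  (forall x, differentiable h x) /\
  (forall x1 x2, enorm (grad h x1 - grad h x2) <= L * enorm (x1 - x2)).

Definition argmin (R : realType) (n : nat) (h : 'rV[R]_n -> R) :
    set 'rV[R]_n :=
  [set x | forall x', h x <= h x'].

(* [inf (range h)] is min h, as the set of minimizers is nonempty. *)
Definition is_PL (R : realType) (n : nat) (mu : R) (h : 'rV[R]_n -> R) : Prop :=
  [/\ argmin h !=set0,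
      forall x, differentiable h x &
      forall x, enorm (grad h x) ^+ 2 >= 2 * mu * (h x - inf (range h))].

Section Bilevel.
Variables (R : realType) (dx dy : nat).
Implicit Types f g : 'rV[R]_dx -> 'rV[R]_dy -> R.

(* A function of (x, y) seen as a function on R^(dx + dy), where z is the
   concatenation of x and y. *)
Definition joint f (z : 'rV[R]_(dx + dy)) : R := f (lsubmx z) (rsubmx z).

Definition hess (n : nat) (h : 'rV[R]_n -> R) (z : 'rV[R]_n) : 'M[R]_n :=
  'J (grad h) z.

(* Entry (i, j) is d^2 f / dx_i dy_j. *)
Definition hess_xy f (x : 'rV[R]_dx) (y : 'rV[R]_dy) : 'M[R]_(dx, dy) :=
  'J (fun x' => grad (f x') y) x.

Definition hess_yy f (x : 'rV[R]_dx) (y : 'rV[R]_dy) : 'M[R]_dy :=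
  hess (f x) y.

Definition matrix_lipschitz (m n : nat) (rho : R)
    (H : 'rV[R]_dx -> 'rV[R]_dy -> 'M[R]_(m, n)) : Prop :=
  forall x1 y1 x2 y2,
    opnorm (H x1 y1 - H x2 y2) <= rho * enorm (row_mx (x1 - x2) (y1 - y2)).

Definition penalized f g (sigma : R) (x : 'rV[R]_dx) (y : 'rV[R]_dy) : R :=
  sigma * f x y + g x y.

Record standing_assumption f g (sigmabar mu C_f L_f L_g rho_f rho_g : R) :
    Prop := StandingAssumption {
  sigmabar_gt0 : 0 < sigmabar;
  mu_gt0 : 0 < mu;
  C_f_gt0 : 0 < C_f;
  L_f_gt0 : 0 < L_f;
  L_g_gt0 : 0 < L_g;
  rho_f_gt0 : 0 < rho_f;
  rho_g_gt0 : 0 < rho_g;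
  penalized_PL : forall sigma, 0 <= sigma <= sigmabar ->
    forall x, is_PL mu (penalized f g sigma x);
  f_lipschitz_y : forall x y1 y2,
    `|f x y1 - f x y2| <= C_f * enorm (y1 - y2);
  f_lipschitz_gradient : lipschitz_gradient L_f (joint f);
  g_lipschitz_gradient : lipschitz_gradient L_g (joint g);
  f_hess_xy_exists : forall x y,
    differentiable (fun x' => grad (f x') y) x;
  f_hess_yy_exists : forall x y, differentiable (grad (f x)) y;
  f_hess_xy_lipschitz : matrix_lipschitz rho_f (hess_xy f);
  f_hess_yy_lipschitz : matrix_lipschitz rho_f (hess_yy f);
  g_twice_differentiable : forall z, differentiable (grad (joint g)) z;
  g_hess_lipschitz :
    matrix_lipschitz rho_g (fun x y => hess (joint g) (row_mx x y))
}.

Definition Ystar g (x : 'rV[R]_dx) : set 'rV[R]_dy := argmin (g x).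

Definition hyper_objective f g (x : 'rV[R]_dx) : R :=
  inf [set f x y | y in Ystar g x].

(* The infimum in [hyper_objective] is a minimum. *)
Definition hyper_objective_attained f g : Prop :=
  forall x, exists y, [/\ Ystar g x y,
    hyper_objective f g x = f x y &
    forall y', Ystar g x y' -> f x y <= f x y'].

End Bilevel.

(* Main.v *)
Require Import Defs.
From HB Require Import structures.
From mathcomp Require Import all_boot all_order all_algebra.
From mathcomp Require Import all_classical all_reals all_analysis.
From mathcomp Require Import ring lra.

Set Implicit Arguments.
Unset Strict Implicit.
Unset Printing Implicit Defensive.

Import Order.TTheory GRing.Theory Num.Theory.
Import numFieldNormedType.Exports.

Local Open Scope classical_set_scope.
Local Open Scope ring_scope.

(* Fix [x1] and [y1] in [Ystar g x1]. The PL inequality gives an error bound: the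
   distance from [y] to the minimisers of a PL function is [O(|grad y| / mu)].
   Applied to [sigma f + g] at [y1], it yields minimisers [y_sigma] with
   [|y_sigma - y1| = O(sigma kappa)], so [f x1] is constant on [Ystar g x1] and a
   cluster point [p] of [(y_sigma - y1) / sigma] solves [p g_yy = - f_y] with
   [|p| = O(kappa)]. Applied to [g x2] at [y1], it yields [y2] in [Ystar g x2]
   with [|y2 - y1| = O(kappa |x2 - x1|)]. Pairing the expansion of
   [g_y(x2, y2) - g_y(x1, y1) = 0] with [p] eliminates the [y]-direction from the
   expansion of [f(x2, y2) - f(x1, y1)], so the hyper-objective has a first-order
   expansion at every point with remainder [O(l kappa^3 |x2 - x1|^2)], and such a
   two-sided expansion forces the gradient to be Lipschitz. *)

(** * Euclidean inner product and norm *)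

Definition dot (R : realType) (n : nat) (u v : 'rV[R]_n) : R :=
  \sum_(i < n) u ord0 i * v ord0 i.

Section Dot.
Variables (R : realType) (n : nat).
Implicit Types u v w : 'rV[R]_n.

Lemma dotC u v : dot u v = dot v u.
Proof. by apply: eq_bigr => i _; rewrite mulrC. Qed.

Lemma dot_is_linear u : linear (dot u).
Proof.
move=> a v w; rewrite /dot scaler_sumr -big_split /=.
by apply: eq_bigr => i _; rewrite !mxE /GRing.scale /=; ring.
Qed.

(** Makes [linear_differentiable], [diff_lin] and [linear0] available for pairing with a fixed
    vector. *)
HB.instance Definition _ u := GRing.isLinear.Build _ _ _ _ (dot u)
  (dot_is_linear u).

Lemma dotDr u v w : dot u (v + w) = dot u v + dot u w.
Proof. exact: linearD. Qed.

Lemma dotBr u v w : dot u (v - w) = dot u v - dot u w.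
Proof. exact: linearB. Qed.

Lemma dotNr u v : dot u (- v) = - dot u v.
Proof. exact: linearN. Qed.

Lemma dotZr a u v : dot u (a *: v) = a * dot u v.
Proof. exact: linearZ. Qed.

Lemma dotDl u v w : dot (u + v) w = dot u w + dot v w.
Proof. by rewrite !(dotC _ w) dotDr. Qed.

Lemma dotBl u v w : dot (u - v) w = dot u w - dot v w.
Proof. by rewrite !(dotC _ w) dotBr. Qed.

Lemma dotNl u v : dot (- u) v = - dot u v.
Proof. by rewrite dotC dotNr dotC. Qed.

Lemma dotZl a u v : dot (a *: u) v = a * dot u v.
Proof. by rewrite dotC dotZr dotC. Qed.

Lemma enormE v : enorm v = Num.sqrt (dot v v).
Proof. by congr Num.sqrt; apply: eq_bigr => i _; rewrite expr2. Qed.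

Lemma dot_ge0 v : 0 <= dot v v.
Proof. by apply: sumr_ge0 => i _; rewrite -expr2 sqr_ge0. Qed.

Lemma enorm_ge0 v : 0 <= enorm v.
Proof. exact: sqrtr_ge0. Qed.

Lemma sqr_enorm v : enorm v ^+ 2 = dot v v.
Proof. by rewrite enormE sqr_sqrtr // dot_ge0. Qed.

Lemma enormZ a v : enorm (a *: v) = `|a| * enorm v.
Proof.
by rewrite !enormE dotZl dotZr mulrA -expr2 sqrtrM ?sqr_ge0 // sqrtr_sqr.
Qed.

Lemma enormN v : enorm (- v) = enorm v.
Proof. by rewrite -scaleN1r enormZ normrN1 mul1r. Qed.

Lemma enorm0 : enorm (0 : 'rV[R]_n) = 0.
Proof. by rewrite -(scale0r 0) enormZ normr0 mul0r. Qed.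

Lemma enormB u v : enorm (u - v) = enorm (v - u).
Proof. by rewrite -enormN opprB. Qed.

Lemma enorm_eq0 v : enorm v = 0 -> v = 0.
Proof.
move=> v0; have := sqr_enorm v; rewrite v0 expr0n /= => /esym /eqP.
rewrite psumr_eq0 => [/allP h|i _]; last by rewrite -expr2 sqr_ge0.
apply/rowP => i; rewrite mxE; have := h i (mem_index_enum i).
by rewrite /= mulf_eq0 orbb => /eqP.
Qed.

Lemma dot_le u v : dot u v <= enorm u * enorm v.
Proof.
have [/enorm_eq0 -> | u0] := eqVneq (enorm u) 0.
  by rewrite -(scale0r u) dotZl mul0r mulr_ge0 ?enorm_ge0.
have [/enorm_eq0 -> | v0] := eqVneq (enorm v) 0.
  by rewrite -(scale0r v) dotZr mul0r mulr_ge0 ?enorm_ge0.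
have up : 0 < enorm u by rewrite lt_def u0 enorm_ge0.
have vp : 0 < enorm v by rewrite lt_def v0 enorm_ge0.
(* Cauchy-Schwarz: expanding this square gives twice [enorm u * enorm v] times the gap to be shown
   nonnegative. *)
have := dot_ge0 (enorm v *: u - enorm u *: v).
rewrite dotBl !dotBr !dotZl !dotZr -!sqr_enorm (dotC v u) => h.
have {}h : 0 <= (enorm u * enorm v) * (enorm u * enorm v - dot u v) by lra.
by move: h; rewrite pmulr_rge0 ?mulr_gt0 // subr_ge0.
Qed.

Lemma abs_dot_le u v : `|dot u v| <= enorm u * enorm v.
Proof. by rewrite ler_norml dot_le andbT lerNl -dotNr -(enormN v) dot_le. Qed.

Lemma ler_enormD u v : enorm (u + v) <= enorm u + enorm v.
Proof.
rewrite -(@ler_pXn2r _ 2) ?nnegrE ?addr_ge0 ?enorm_ge0 //.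
rewrite sqr_enorm dotDl !dotDr (dotC v u) -!sqr_enorm.
by have := dot_le u v; lra.
Qed.

(** Test with [w := u]. It reduces bounds on vectors to scalar ones, to which the mean value theorem
    applies. *)
Lemma enorm_le_dual u (c : R) : 0 <= c ->
  (forall w, dot u w <= c * enorm w) -> enorm u <= c.
Proof.
move=> c0 /(_ u); rewrite -sqr_enorm expr2.
have [->//|u0] := eqVneq (enorm u) 0.
by rewrite ler_pM2r // lt_def u0 enorm_ge0.
Qed.

Lemma coord_le_enorm v i : `|v ord0 i| <= enorm v.
Proof.
rewrite -(@ler_pXn2r _ 2) ?nnegrE ?normr_ge0 ?enorm_ge0 // real_normK ?num_real//.
rewrite sqr_enorm /dot (bigD1 i) //= -expr2 lerDl.
by apply: sumr_ge0 => j _; rewrite -expr2 sqr_ge0.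
Qed.

Lemma coord_le_norm v i : `|v ord0 i| <= `|v|.
Proof.
rewrite [leRHS]/Num.norm /= mx_normrE.
by apply/bigmax_geP; right => /=; exists (ord0, i).
Qed.

Lemma norm_le_enorm v : `|v| <= enorm v.
Proof.
rewrite [leLHS]/Num.norm /= mx_normrE; apply/bigmax_leP; split => [|[i j] _] /=.
  exact: enorm_ge0.
by rewrite (ord1 i) coord_le_enorm.
Qed.

(** The factor [n] only serves to prove differentiability, a little-o statement in the max norm; it
    does not enter the final constant. *)
Lemma sqr_enorm_le_norm v : enorm v ^+ 2 <= n%:R * `|v| ^+ 2.
Proof.
have -> : n%:R * `|v| ^+ 2 = \sum_(i < n) `|v| ^+ 2.
  by rewrite sumr_const card_ord mulr_natl.
rewrite sqr_enorm; apply: ler_sum => i _; rewrite -expr2 -(real_normK (num_real (v _ _))).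
by rewrite ler_pXn2r ?nnegrE ?normr_ge0 // coord_le_norm.
Qed.

Lemma continuous_dot u : continuous (dot u).
Proof.
have -> : dot u = \sum_(i < n) (cst (u ord0 i) * (fun v : 'rV[R]_n => v ord0 i)).
  by apply/funext => v; rewrite fct_sumE.
move=> v; elim/big_ind : _ => [|f g cf cg|i _].
- exact: cst_continuous.
- exact: continuousD.
- by apply: continuousM; [exact: cst_continuous|exact: coord_continuous].
Qed.

Lemma continuous_enorm_affine (m : nat) (A : 'M[R]_(n, m)) (b : 'rV[R]_m) :
  continuous (fun v : 'rV[R]_n => enorm (v *m A + b)).
Proof.
move=> v.
have -> : (fun v : 'rV[R]_n => enorm (v *m A + b)) =
    Num.sqrt \o \sum_(j < m) (fun v => (dot (row j A^T) v + b ord0 j) ^+ 2).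
  apply/funext => w; rewrite /= fct_sumE; congr Num.sqrt.
  apply: eq_bigr => j _; rewrite !mxE; congr ((_ + _) ^+ 2).
  by apply: eq_bigr => i _; rewrite !mxE mulrC.
apply: continuous_comp; last exact: sqrt_continuous.
elim/big_ind : _ => [|f g cf cg|j _].
- exact: cst_continuous.
- exact: continuousD.
- apply: (@continuous_comp _ _ _ (fun v => dot (row j A^T) v + b ord0 j)
      (fun t => t ^+ 2)); last exact: exprn_continuous.
  by apply: continuousD; [exact: continuous_dot|exact: cst_continuous].
Qed.

Lemma continuous_enorm_dist (y : 'rV[R]_n) :
  continuous (fun z : 'rV[R]_n => enorm (z - y)).
Proof.
have -> : (fun z : 'rV[R]_n => enorm (z - y)) =
    (fun z => enorm (z *m 1%:M - y)) by apply/funext => z; rewrite mulmx1.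
exact: continuous_enorm_affine.
Qed.

Lemma compact_enorm_ball (y : 'rV[R]_n) (r : R) :
  compact [set z | enorm (z - y) <= r].
Proof.
apply: bounded_closed_compact.
  exists (`|y| + r); split; first exact: num_real.
  move=> M hM z /= hz; apply: le_trans (ltW hM).
  rewrite -(subrK y z) addrC; apply: le_trans (ler_normD _ _) _.
  by rewrite lerD2l; exact: le_trans (norm_le_enorm _) hz.
exact: (continuous_closedP _).1 (@continuous_enorm_dist y) _ (@closed_le _ r).
Qed.

End Dot.

(** Used for limits as [t] tends to 0: an estimate is divided by [t], and the remaining error is
    linear in [t]. *)
Lemma le0_of_small (R : realType) (x c t0 : R) : 0 < t0 ->
  (forall t, 0 < t <= t0 -> x <= c * t) -> x <= 0.
Proof.
move=> t0p h; rewrite leNgt; apply/negP => xp.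
have cp : 0 < `|c| + 1 by rewrite ltr_wpDl.
pose t := Num.min t0 (x / (2 * (`|c| + 1))).
have tp : 0 < t by rewrite lt_min t0p divr_gt0 // mulr_gt0.
have tle : t * (2 * (`|c| + 1)) <= x.
  by rewrite -ler_pdivlMr ?mulr_gt0 // ge_min lexx orbT.
have := h t; rewrite tp ge_min lexx => /(_ isT) xc.
have : c * t <= `|c| * t by rewrite ler_pM2r // ler_norm.
nra.
Qed.

(** * Norms of concatenated vectors and of matrix products *)

Section BlockVectors.
Variables (R : realType) (m n : nat).
Implicit Types (a c : 'rV[R]_m) (b d : 'rV[R]_n) (z : 'rV[R]_(m + n)).

Lemma dot_row_mx a b c d : dot (row_mx a b) (row_mx c d) = dot a c + dot b d.
Proof.
rewrite /dot big_split_ord /=; congr (_ + _); apply: eq_bigr => i _.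
  by rewrite !row_mxEl.
by rewrite !row_mxEr.
Qed.

Lemma sqr_enorm_row_mx a b :
  enorm (row_mx a b) ^+ 2 = enorm a ^+ 2 + enorm b ^+ 2.
Proof. by rewrite !sqr_enorm dot_row_mx. Qed.

Lemma enorm_row_mx_le a b : enorm (row_mx a b) <= enorm a + enorm b.
Proof.
rewrite -(@ler_pXn2r _ 2) ?nnegrE ?addr_ge0 ?enorm_ge0 // sqr_enorm_row_mx.
by have := mulr_ge0 (enorm_ge0 a) (enorm_ge0 b); nra.
Qed.

Lemma enorm_row_0mx b : enorm (row_mx (0 : 'rV[R]_m) b) = enorm b.
Proof.
apply/eqP; rewrite -(@eqrXn2 _ 2) ?enorm_ge0 // sqr_enorm_row_mx enorm0.
by rewrite expr0n add0r.
Qed.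

Lemma enorm_row_mx0 a : enorm (row_mx a (0 : 'rV[R]_n)) = enorm a.
Proof.
apply/eqP; rewrite -(@eqrXn2 _ 2) ?enorm_ge0 // sqr_enorm_row_mx enorm0.
by rewrite expr0n addr0.
Qed.

Lemma enorm_rsubmx_le z : enorm (rsubmx z) <= enorm z.
Proof.
rewrite -(@ler_pXn2r _ 2) ?nnegrE ?enorm_ge0 // -{2}(hsubmxK z).
by rewrite sqr_enorm_row_mx lerDr sqr_ge0.
Qed.

End BlockVectors.

Lemma enorm_mulmx_le (R : realType) (m n : nat) (A : 'M[R]_(m, n))
  (v : 'rV[R]_m) : enorm (v *m A) <= opnorm A * enorm v.
Proof.
(* [K] is the Frobenius norm of [A]. It bounds the set defining [opnorm A], so that its [sup] is a
   genuine supremum. *)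
pose K := Num.sqrt (\sum_(j < n) enorm (row j A^T) ^+ 2).
have K2 : K ^+ 2 = \sum_(j < n) enorm (row j A^T) ^+ 2.
  by rewrite sqr_sqrtr // sumr_ge0 // => j _; exact: sqr_ge0.
have bK u : enorm (u *m A) <= K * enorm u.
  rewrite -(@ler_pXn2r _ 2) ?nnegrE ?mulr_ge0 ?sqrtr_ge0 ?enorm_ge0 //.
  rewrite exprMn K2.
  rewrite mulr_suml sqr_enorm; apply: ler_sum => j _.
  rewrite -expr2 -(real_normK (num_real (_ ord0 j))) -exprMn.
  rewrite ler_pXn2r ?nnegrE ?normr_ge0 ?mulr_ge0 ?enorm_ge0 //.
  have -> : (u *m A) ord0 j = dot (row j A^T) u.
    by rewrite mxE; apply: eq_bigr => i _; rewrite !mxE mulrC.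
  exact: abs_dot_le.
have [/enorm_eq0 ->|v0] := eqVneq (enorm v) 0.
  by rewrite mul0mx !enorm0 mulr0.
have vp : 0 < enorm v by rewrite lt_def v0 enorm_ge0.
rewrite -ler_pdivrMr //; apply: ub_le_sup.
  exists K => _ [u u1 <-]; apply: le_trans (bK u) _.
  by rewrite -[leRHS]mulr1 ler_wpM2l // sqrtr_ge0.
exists ((enorm v)^-1 *: v).
  by rewrite /= enormZ ger0_norm ?invr_ge0 ?enorm_ge0 // mulVf.
by rewrite -scalemxAl enormZ ger0_norm ?invr_ge0 ?enorm_ge0 // mulrC.
Qed.

(** * Taylor estimates with dimension-free constants *)

Section Calculus.
Variables (R : realType) (n : nat).
Implicit Types (h : 'rV[R]_n -> R) (z u v w : 'rV[R]_n).

Lemma derive_grad h z v : differentiable h z -> 'D_v h z = dot (grad h z) v.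
Proof.
move=> dh; rewrite deriveE // {1}(row_sum_delta v) linear_sum.
by apply: eq_bigr => i _; rewrite linearZ /= mxE deriveE // mulrC.
Qed.

Lemma mvt_line h z v : (forall x, differentiable h x) ->
  exists2 t, 0 <= t <= 1 & h (z + v) - h z = 'D_v h (z + t *: v).
Proof.
move=> dh; pose p (t : R) := h (t *: v + z).
(* The difference quotients of [p] at [t] are those of [h] at [t *: v + z] in direction [v]. *)
have E t : (fun k : R => k^-1 *: ((p \o shift t) (k *: 1) - p t)) =
    (fun k : R => k^-1 *: ((h \o shift (t *: v + z)) (k *: v) - h (t *: v + z))).
  apply/funext => k /=; rewrite /p /= [k%:A]mulr1 scalerDl.
  by rewrite addrA.
have dp (t : R) : is_derive t 1 p ('D_v h (t *: v + z)).
  apply: DeriveDef; last by rewrite /derive E.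
  rewrite /derivable E; exact: diff_derivable.
have cp : {within `[0, 1], continuous p}.
  by apply: derivable_within_continuous => t _; have [] := dp t.
have [t] := MVT_segment ler01 (fun t _ => dp t) cp.
rewrite in_itv /= /p scale1r scale0r add0r subr0 mulr1 => t01 e.
by exists t => //; rewrite [z + v]addrC e addrC.
Qed.

(** The mean value theorem replaces integration along the segment, hence the constant [L] and not
    [L / 2]. *)
Lemma gradient_taylor h L z v : 0 <= L -> lipschitz_gradient L h ->
  `|h (z + v) - h z - dot (grad h z) v| <= L * enorm v ^+ 2.
Proof.
move=> L0 [dh lh]; have [t /andP[t0 t1] ->] := mvt_line z v dh.
rewrite derive_grad // -dotBl; apply: le_trans (abs_dot_le _ _) _.
rewrite expr2 mulrA ler_wpM2r ?enorm_ge0 //; apply: le_trans (lh _ _) _.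
rewrite ler_wpM2l // addrC addKr enormZ ger0_norm // ler_piMl //.
exact: enorm_ge0.
Qed.

Section Hessian.
Variables (h : 'rV[R]_n -> R) (rho : R).
Hypotheses (rho0 : 0 <= rho) (dh : forall z, differentiable h z)
  (ddh : forall z, differentiable (grad h) z)
  (lH : forall z1 z2, opnorm (hess h z1 - hess h z2) <= rho * enorm (z1 - z2)).

(** By duality it suffices to pair with a fixed [w] and apply the mean value theorem to the scalar
    function [dot w \o grad h]. *)
Lemma hessian_taylor z v :
  enorm (grad h (z + v) - grad h z - v *m hess h z) <= rho * enorm v ^+ 2.
Proof.
apply: enorm_le_dual => [|w]; first by rewrite mulr_ge0 // sqr_ge0.
pose k := dot w \o grad h.
have cw : continuous (dot w) by exact: continuous_dot.
have dk x : differentiable k x.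
  by apply: differentiable_comp => //; exact: linear_differentiable.
have kD x : 'D_v k x = dot w (v *m hess h x).
  rewrite deriveE // diff_comp //; last exact: linear_differentiable.
  by rewrite /= diff_lin // -deriveE // deriveEjacobian.
have [t /andP[t0 t1]] := mvt_line z v dk.
rewrite kD /k /= => e; rewrite dotC 2!dotBr e -dotBr -mulmxBr.
apply: le_trans (dot_le _ _) _; rewrite mulrC ler_wpM2r ?enorm_ge0 //.
apply: le_trans (enorm_mulmx_le _ _) _.
rewrite expr2 mulrA ler_wpM2r ?enorm_ge0 //; apply: le_trans (lH _ _) _.
rewrite ler_wpM2l // addrC addKr enormZ ger0_norm // ler_piMl //.
exact: enorm_ge0.
Qed.

(** The mean value theorem in direction [v], applied to the increment of [h] by [u], leaves a
    gradient increment to which [hessian_taylor] applies. *)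
Lemma second_difference z u v :
  `|h (z + v + u) - h (z + v) - (h (z + u) - h z) - dot (u *m hess h z) v| <=
  rho * enorm u * enorm v * (enorm u + enorm v).
Proof.
pose k x := h (x + u) - h x.
have dsh x : differentiable (h \o (fun x => x + u)) x.
  apply: differentiable_comp (dh _).
  have di : differentiable (@idfun 'rV[R]_n) x by exact: ex_diff.
  exact: differentiableD di (differentiable_cst u x).
have dk x : differentiable k x by exact: differentiableB (dsh x) (dh x).
have gsh x : 'D_v (h \o (fun x => x + u)) x = dot (grad h (x + u)) v.
  rewrite -derive_grad // /derive; apply: (congr1 (fun q : R -> R => lim (q @ 0^'))).
  apply/funext => s /=.
  by rewrite addrA.
have kD x : 'D_v k x = dot (grad h (x + u) - grad h x) v.
  rewrite deriveB; try exact: diff_derivable.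
  by rewrite gsh derive_grad // dotBl.
have [t /andP[t0 t1]] := mvt_line z v dk.
rewrite kD /k => ->; rewrite -dotBl; apply: le_trans (abs_dot_le _ _) _.
(* Moving the Hessian from [a] back to [z] costs at most [rho * enorm v * enorm u]. *)
set a := z + t *: v.
have -> : grad h (a + u) - grad h a - u *m hess h z =
    (grad h (a + u) - grad h a - u *m hess h a) +
    u *m (hess h a - hess h z) by rewrite mulmxBr addrA subrK.
apply: (@le_trans _ _ ((rho * enorm u ^+ 2 + rho * enorm v * enorm u) * enorm v)).
  rewrite ler_wpM2r ?enorm_ge0 //; apply: le_trans (ler_enormD _ _) _.
  apply: lerD; first exact: hessian_taylor.
  apply: le_trans (enorm_mulmx_le _ _) _.
  rewrite ler_wpM2r ?enorm_ge0 //; apply: le_trans (lH _ _) _.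
  rewrite ler_wpM2l // addrC addKr enormZ ger0_norm // ler_piMl //.
  exact: enorm_ge0.
by rewrite le_eqVlt; apply/orP; left; apply/eqP; ring.
Qed.

(** The second difference is symmetric in [u] and [v]. For [t *: u] and [t *: v] its error is of
    order [t ^+ 3], while the bilinear terms scale as [t ^+ 2]. *)
Lemma hessian_symmetric z u v : dot (u *m hess h z) v = dot (v *m hess h z) u.
Proof.
apply/subr0_eq/eqP; rewrite -normr_le0.
pose c := 2 * (rho * enorm u * enorm v * (enorm u + enorm v)).
apply: (@le0_of_small _ _ c 1) => // t /andP[t0 _].
have := second_difference z (t *: u) (t *: v).
have := second_difference z (t *: v) (t *: u).
rewrite (_ : z + t *: u + t *: v = z + t *: v + t *: u); last by rewrite addrAC.
rewrite -!scalemxAl !dotZl !dotZr !enormZ (gtr0_norm t0).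
set A := h _; set B := h _; set C := h _; set D := h _.
set p := dot _ _; set q := dot _ _.
move=> h1 h2.
have : `|t ^+ 2 * (q - p)| <= t ^+ 2 * (c * t).
  have -> : t ^+ 2 * (q - p) = (A - B - (C - D) - t * (t * p)) -
      (A - C - (B - D) - t * (t * q)) by ring.
  apply: le_trans (ler_normB _ _) _; apply: le_trans (lerD h1 h2) _.
  by rewrite le_eqVlt; apply/orP; left; apply/eqP; rewrite /c; ring.
by rewrite normrM ger0_norm ?sqr_ge0 // ler_pM2l ?exprn_gt0.
Qed.

End Hessian.

Lemma quadratic_expansion_grad h p z M :
  (forall w, `|h w - h z - dot p (w - z)| <= M * enorm (w - z) ^+ 2) ->
  differentiable h z /\ grad h z = p.
Proof.
move=> hM.
have M0 : 0 <= `|M| by [].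
have E : h \o shift z =
    cst (h z) + (dot p : 'rV[R]_n -> R) +o_ (0 : 'rV[R]_n) id.
  apply/eqaddoP => _/posnumP[e].
  (* The [+ 1] keeps the denominator positive when [M] or [n] is 0. *)
  have dp : 0 < e%:num / (`|M| * n%:R + 1).
    by rewrite divr_gt0 // ltr_wpDl // mulr_ge0.
  near=> v.
  have := hM (v + z); rewrite addrK => /= hv.
  have -> : (h \o shift z - (cst (h z) + dot p)) v = h (v + z) - h z - dot p v.
    by rewrite !fctE /= opprD addrA.
  apply: le_trans hv _; apply: le_trans (ler_wpM2r (sqr_ge0 _) (ler_norm M)) _.
  apply: le_trans (ler_wpM2l M0 (sqr_enorm_le_norm _)) _.
  rewrite expr2 !mulrA ler_wpM2r // -mulrA.
  suff : `|v| <= e%:num / (`|M| * n%:R + 1).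
    rewrite ler_pdivlMr; last by rewrite ltr_wpDl // mulr_ge0.
    apply: le_trans; rewrite mulrA mulrC ler_wpM2l //.
    by rewrite lerDl.
  by near: v; exact: (@nbhs0_le _ 'rV[R]_n _ dp).
have D : 'd h z = dot p :> (_ -> _).
  by apply: diff_unique E; exact: continuous_dot.
split.
  apply/diff_locallyP; rewrite D; split => //; exact: continuous_dot.
have dh : differentiable h z.
  apply/diff_locallyP; rewrite D; split => //; exact: continuous_dot.
apply/rowP => i; rewrite mxE deriveE // D /dot (bigD1 i) //= big1 => [|j ji].
  by rewrite mxE !eqxx mulr1 addr0.
by rewrite mxE (negbTE ji) andbF mulr0.
Unshelve. all: by end_near. Qed.

(** Three expansions are combined: from [z] to the test point, from [x] to it, and from [x] to [z].
    The displacements are at most [r], [2 * r] and [r], so the errors add up to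
    [(1 + 4 + 1) * M * r ^+ 2]. *)
Lemma quadratic_expansion_lipschitz_gradient h (P : 'rV[R]_n -> 'rV[R]_n) M :
  0 <= M ->
  (forall z w, `|h w - h z - dot (P z) (w - z)| <= M * enorm (w - z) ^+ 2) ->
  lipschitz_gradient (6 * M) h.
Proof.
move=> M0 hM.
have gP z : grad h z = P z by have [] := quadratic_expansion_grad (hM z).
split => [z|x z]; first by have [] := quadratic_expansion_grad (hM z).
rewrite !gP enormB.
have [xz|xz] := eqVneq (P z - P x) 0.
  by rewrite xz enorm0 !mulr_ge0 ?enorm_ge0.
set r := enorm (x - z); set g := P z - P x.
have gp : 0 < enorm g.
  by rewrite lt_def enorm_ge0 andbT; apply: contra_neq xz => /enorm_eq0.
(* The test point is displaced from [z] by a vector [u] of length [r] in the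
   direction of the difference of the gradients. *)
pose u := (r / enorm g) *: g.
have r0 : 0 <= r by exact: enorm_ge0.
have nu : enorm u = r.
  by rewrite enormZ ger0_norm ?divr_ge0 ?enorm_ge0 // divfK // gt_eqF.
have h1 := hM z (z + u); have h2 := hM x (z + u); have h3 := hM x z.
have nzx : enorm (z - x) = r by rewrite enormB.
have n2 : enorm (z + u - x) <= 2 * r.
  rewrite addrAC; apply: le_trans (ler_enormD _ _) _.
  by rewrite nu nzx; lra.
have n2' : enorm (z + u - x) ^+ 2 <= 4 * r ^+ 2.
  by have := enorm_ge0 (z + u - x); nra.
move: h1 h2 h3; rewrite [z + u - z]addrC addKr nu nzx !ler_norml.
move=> /andP[h1 _] /andP[_ h2] /andP[h3 _].
have n3 := ler_wpM2l M0 n2'.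
have e : dot g u = dot (P z) u - dot (P x) (z + u - x) + dot (P x) (z - x).
  by rewrite /g dotBl [z + u - x]addrAC [dot _ (z - x + u)]dotDr; ring.
have gu : dot g u = r * enorm g.
  by rewrite dotZr -sqr_enorm expr2 mulrA divfK // gt_eqF.
have H : r * enorm g <= r * (6 * M * r) by rewrite -gu e; lra.
have [r00|rn0] := eqVneq r 0.
  have /enorm_eq0 /subr0_eq xz' := r00.
  by rewrite /g xz' subrr enorm0 !mulr_ge0.
by move: H; rewrite ler_pM2l // lt_def rn0.
Qed.

End Calculus.

(** * Gradient steps and the error bound for PL functions *)

Section GradientLipschitz.
Variables (R : realType) (n : nat) (h : 'rV[R]_n -> R) (L : R).
Hypotheses (L0 : 0 < L) (lh : lipschitz_gradient L h).

Lemma gradient_step z (t : R) : 0 <= t ->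
  h (z - t *: grad h z) <= h z - t * (1 - L * t) * enorm (grad h z) ^+ 2.
Proof.
move=> t0; have := gradient_taylor z (- (t *: grad h z)) (ltW L0) lh.
rewrite ler_norml => /andP[_].
by rewrite dotNr dotZr -sqr_enorm enormN enormZ ger0_norm // => H; lra.
Qed.

(** A gradient step of size [t] cannot go below the minimum; divide by [t] and let it tend to 0. *)
Lemma grad_argmin z : argmin h z -> grad h z = 0.
Proof.
move=> hz; apply: enorm_eq0; apply/eqP; rewrite -sqrf_eq0 eq_le sqr_ge0 andbT.
apply: (@le0_of_small _ _ (L * enorm (grad h z) ^+ 2) 1) => // t /andP[t0 _].
have H := le_trans (hz _) (gradient_step z (ltW t0)).
have : t * (enorm (grad h z) ^+ 2) <= t * (L * enorm (grad h z) ^+ 2 * t) by lra.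
by rewrite ler_pM2l.
Qed.

(* A point [z] minimising [sqrt (h z - min h) + a |z - y|] is a minimiser of [h]
   when [a] is small: otherwise the PL inequality makes one gradient step of
   length [1 / (2 L)] decrease the first term by more than it increases the
   second. *)
Lemma PL_error_bound (mu : R) (y : 'rV[R]_n) : 0 < mu -> is_PL mu h ->
  exists2 z, argmin h z & mu * enorm (z - y) <= 4 * enorm (grad h y).
Proof.
move=> mu0 [[xm hxm] dh PL]; set m := inf (range h) in PL.
have mle x : m <= h x.
  by apply: ge_inf; [exists (h xm) => _ [w _ <-]; exact: hxm|exists x].
have mE : h xm <= m.
  by apply: lb_le_inf; [exists (h xm), xm|move=> _ [w _ <-]; exact: hxm].
pose s := Num.sqrt mu; have s0 : 0 < s by rewrite sqrtr_gt0.
have s2 : s ^+ 2 = mu by rewrite sqr_sqrtr // ltW.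
pose q x := Num.sqrt (h x - m).
have q0 x : 0 <= q x by exact: sqrtr_ge0.
have q2 x : q x ^+ 2 = h x - m by rewrite sqr_sqrtr // subr_ge0.
pose F x := q x + s / 4 * enorm (x - y).
have cF : continuous F.
  have -> : F = q + cst (s / 4) * (fun x => enorm (x - y)) by [].
  move=> x; apply: continuousD; last first.
    by apply: continuousM; [exact: cst_continuous|exact: continuous_enorm_dist].
  apply: (@continuous_comp _ _ _ (h - cst m) Num.sqrt).
    apply: continuousB; last exact: cst_continuous.
    exact: differentiable_continuous.
  exact: sqrt_continuous.
(* Outside the ball of radius [r] about [y] the distance term alone exceeds [F y], so a minimiser of
   [F] on the ball is global. *)
pose r := q y / (s / 4).
have r0 : 0 <= r by rewrite divr_ge0 // ltW // divr_gt0.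
have Fy : F y = q y by rewrite /F subrr enorm0 mulr0 addr0.
have [|z _ zK] := compact_EVT_min _ (@compact_enorm_ball _ _ y r)
    (continuous_subspaceT cF).
  by exists y; rewrite /= subrr enorm0.
have zmin w : F z <= F w.
  have [wr|wr] := leP (enorm (w - y)) r; first by apply: zK; rewrite inE.
  apply: (@le_trans _ _ (F y)).
    by apply: zK; rewrite inE /= subrr enorm0.
  rewrite Fy /F; apply: (@le_trans _ _ (s / 4 * enorm (w - y))).
    by rewrite mulrC -ler_pdivrMr ?divr_gt0 // ltW.
  by rewrite lerDr.
exists z; last first.
  (* [F z <= F y] bounds the distance by [q y], and PL at [y] bounds [q y] by the gradient; the
     weight [s / 4] yields the constant 4. *)
  have H := zmin y; rewrite Fy /F in H.
  have := PL y; rewrite -q2 -s2 => H2.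
  have H3 : s * q y <= enorm (grad h y).
    rewrite -(@ler_pXn2r _ 2) ?nnegrE ?mulr_ge0 ?enorm_ge0 ?(ltW s0) //.
    by apply: le_trans H2; rewrite exprMn; have := sqr_ge0 (s * q y); lra.
  have H4 : s / 4 * enorm (z - y) <= q y by have := q0 z; lra.
  have := ler_wpM2l (ltW s0) H4; lra.
suff hz : h z = m by move=> w; rewrite hz.
have [//|hz] := eqVneq (h z) m; exfalso.
have dp : 0 < h z - m by rewrite subr_gt0 lt_def hz mle.
have qp : 0 < q z by rewrite sqrtr_gt0.
set g := enorm (grad h z).
have g0 : 0 <= g by exact: enorm_ge0.
have gPL := PL z; rewrite -/g in gPL.
have gp : 0 < g.
  rewrite lt_def g0 andbT; apply/eqP => ge; move: gPL; rewrite ge expr0n /=.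
  by rewrite leNgt !mulr_gt0.
pose t := (2 * L)^-1.
have tp : 0 < t by rewrite invr_gt0 mulr_gt0.
have Lt : L * t = 2^-1 by rewrite /t invfM mulrCA divff ?gt_eqF // mulr1.
pose w := z - t *: grad h z.
have hw : h w <= h z - t / 2 * g ^+ 2.
  by have := gradient_step z (ltW tp); rewrite -/g Lt -/w; lra.
have qw : q w ^+ 2 <= q z ^+ 2 - t / 2 * g ^+ 2 by rewrite !q2; lra.
have Fw := zmin w; rewrite /F in Fw.
have nw : enorm (w - y) <= enorm (z - y) + t * g.
  rewrite /w addrAC; apply: le_trans (ler_enormD _ _) _.
  by rewrite enormN enormZ gtr0_norm.
have pq : q z - q w <= s / 4 * (t * g).
  have := ler_wpM2l (ltW s0) nw; lra.
have qwz : q w <= q z.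
  rewrite -(@ler_pXn2r _ 2) ?nnegrE //; apply: le_trans qw _.
  by rewrite gerBl mulr_ge0 ?sqr_ge0 // divr_ge0 // ltW.
(* Uses [q z ^+ 2 - q w ^+ 2 <= 2 * q z * (q z - q w)]. The outcome [g <= s * q z] contradicts PL at
   [z], whose factor 2 makes it strictly stronger. *)
have : t / 2 * g ^+ 2 <= 2 * q z * (s / 4 * (t * g)).
  apply: (@le_trans _ _ (2 * q z * (q z - q w))); last first.
    by rewrite ler_pM2l // mulr_gt0.
  have : 0 <= (q z - q w) ^+ 2 by exact: sqr_ge0.
  by nra.
have -> : t / 2 * g ^+ 2 = (t * g / 2) * g by ring.
have -> : 2 * q z * (s / 4 * (t * g)) = (t * g / 2) * (s * q z) by field.
rewrite ler_pM2l ?divr_gt0 ?mulr_gt0 // => gs.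
have : g ^+ 2 <= (s * q z) ^+ 2.
  by rewrite ler_pXn2r ?nnegrE ?mulr_ge0 // ltW.
rewrite exprMn s2 q2 => g2; have := mulr_gt0 mu0 dp; lra.
Qed.

End GradientLipschitz.

(** * Partial gradients in [y], and gradients of combinations *)

Section Partial.
Variables (R : realType) (dx dy : nat).
Variables (f : 'rV[R]_dx -> 'rV[R]_dy -> R) (L : R).
Hypotheses (L0 : 0 <= L) (lf : lipschitz_gradient L (joint f)).

Lemma joint_row_mx x y : joint f (row_mx x y) = f x y.
Proof. by rewrite /joint row_mxKl row_mxKr. Qed.

(** Restricting the joint expansion to displacements [row_mx 0 (w - y)] gives a quadratic expansion
    of [f x], which determines its gradient. *)
Lemma partial_grad x y : differentiable (f x) y /\
  grad (f x) y = rsubmx (grad (joint f) (row_mx x y)).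
Proof.
apply: (@quadratic_expansion_grad _ _ _ _ _ L) => w.
have := gradient_taylor (row_mx x y) (row_mx 0 (w - y)) L0 lf.
rewrite add_row_mx addr0 [y + _]addrC subrK !joint_row_mx enorm_row_0mx.
by rewrite -{1}(hsubmxK (grad _ _)) dot_row_mx linear0 add0r.
Qed.

Lemma partial_lipschitz_gradient x : lipschitz_gradient L (f x).
Proof.
split=> [y|y1 y2]; first by have [] := partial_grad x y.
have [_ ->] := partial_grad x y1; have [_ ->] := partial_grad x y2.
rewrite -linearB; apply: le_trans (enorm_rsubmx_le _) _.
have [_ lf2] := lf; apply: le_trans (lf2 _ _) _.
by rewrite opp_row_mx add_row_mx subrr enorm_row_0mx.
Qed.

Lemma partial_grad_lipschitz x1 x2 y :
  enorm (grad (f x1) y - grad (f x2) y) <= L * enorm (x1 - x2).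
Proof.
have [_ ->] := partial_grad x1 y; have [_ ->] := partial_grad x2 y.
rewrite -linearB; apply: le_trans (enorm_rsubmx_le _) _.
have [_ lf2] := lf; apply: le_trans (lf2 _ _) _.
by rewrite opp_row_mx add_row_mx subrr enorm_row_mx0.
Qed.

End Partial.

Lemma lipschitz_gradient_comb (R : realType) (n : nat) (h1 h2 : 'rV[R]_n -> R)
  (s L1 L2 : R) : 0 <= s -> lipschitz_gradient L1 h1 ->
  lipschitz_gradient L2 h2 ->
  lipschitz_gradient (s * L1 + L2) (fun z => s * h1 z + h2 z) /\
  forall z, grad (fun z => s * h1 z + h2 z) z = s *: grad h1 z + grad h2 z.
Proof.
move=> s0 [d1 l1] [d2 l2].
have dZ z : differentiable (s *: h1) z by exact: differentiableZ.
have gE z : grad (s *: h1 + h2) z = s *: grad h1 z + grad h2 z.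
  apply/rowP => i; rewrite !mxE deriveD; try exact: diff_derivable.
  by rewrite deriveZ //; exact: diff_derivable.
split; last exact: gE.
split=> [z|x1 x2]; first exact: (differentiableD (dZ z) (d2 z)).
rewrite !gE opprD addrACA -scalerBr; apply: le_trans (ler_enormD _ _) _.
by rewrite enormZ ger0_norm // mulrDl -mulrA lerD // ler_wpM2l.
Qed.

Lemma lipschitz_grad_bound (R : realType) (n : nat) (h : 'rV[R]_n -> R)
  (L C : R) z : 0 <= L -> 0 <= C -> lipschitz_gradient L h ->
  (forall w, `|h w - h z| <= C * enorm (w - z)) -> enorm (grad h z) <= C.
Proof.
move=> L0 C0 lh hC; apply: enorm_le_dual => // w; rewrite -subr_le0.
apply: (@le0_of_small _ _ (L * enorm w ^+ 2) 1) => // t /andP[t0 _].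
have := gradient_taylor z (t *: w) L0 lh; have := hC (z + t *: w).
rewrite [z + _ - z]addrC addKr dotZr enormZ (gtr0_norm t0) !ler_norml.
move=> /andP[_ h1] /andP[h2 _].
have : t * (dot (grad h z) w - C * enorm w) <= t * (L * enorm w ^+ 2 * t) by lra.
by rewrite ler_pM2l.
Qed.

(** * Penalised minimisers, the multiplier, and the expansion of the hyper-objective *)

Section HyperObjective.
Variables (R : realType) (dx dy : nat).
Variables (f g : 'rV[R]_dx -> 'rV[R]_dy -> R) (sigmabar mu L : R).
Hypotheses (sigmabar0 : 0 < sigmabar) (mu0 : 0 < mu) (L0 : 0 < L)
  (PL : forall sigma, 0 <= sigma <= sigmabar ->
    forall x, is_PL mu (penalized f g sigma x))
  (f_lip : forall x y1 y2, `|f x y1 - f x y2| <= L * enorm (y1 - y2))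
  (lf : lipschitz_gradient L (joint f))
  (lg : lipschitz_gradient L (joint g))
  (ddg : forall z, differentiable (grad (joint g)) z)
  (lH : forall z1 z2, opnorm (hess (joint g) z1 - hess (joint g) z2) <=
    L * enorm (z1 - z2)).

Let Lge0 : 0 <= L := ltW L0.

Lemma penalized0 x : penalized f g 0 x = g x.
Proof. by apply/funext => y; rewrite /penalized mul0r add0r. Qed.

Lemma g_PL x : is_PL mu (g x).
Proof. by rewrite -penalized0; apply: PL; rewrite lexx ltW. Qed.

Lemma grad_g_Ystar x y : Ystar g x y -> grad (g x) y = 0.
Proof. exact: (grad_argmin L0 (partial_lipschitz_gradient Lge0 lg x)). Qed.

Lemma penalized_lipschitz_gradient sigma x : 0 <= sigma ->
  lipschitz_gradient (sigma * L + L) (penalized f g sigma x) /\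
  forall y, grad (penalized f g sigma x) y =
    sigma *: grad (f x) y + grad (g x) y.
Proof.
move=> s0; apply: lipschitz_gradient_comb => //.
  exact: partial_lipschitz_gradient.
exact: partial_lipschitz_gradient.
Qed.

Lemma grad_f_bound x y : enorm (grad (f x) y) <= L.
Proof.
apply: (lipschitz_grad_bound Lge0 Lge0 (partial_lipschitz_gradient Lge0 lf x)).
by move=> w; exact: f_lip.
Qed.

(** At [y] the gradient of [g x] vanishes, so that of the penalised function is
    [sigma *: grad (f x) y]; the error bound applies. *)
Lemma penalized_minimizer_near sigma x y :
  0 <= sigma <= sigmabar -> Ystar g x y ->
  exists2 ys, argmin (penalized f g sigma x) ys &
    mu * enorm (ys - y) <= 4 * (sigma * L).
Proof.
move=> /[dup] sb /andP[s0 _] yY.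
have [lp gE] := penalized_lipschitz_gradient x s0.
have Lp : 0 < sigma * L + L by rewrite ltr_wpDl // mulr_ge0.
have [ys ysm H] := PL_error_bound Lp lp y mu0 (PL sb x).
exists ys => //; apply: le_trans H _; rewrite ler_pM2l // gE grad_g_Ystar //.
by rewrite addr0 enormZ ger0_norm // ler_wpM2l // grad_f_bound.
Qed.

(* The values of [f x] at minimisers of [penalized f g sigma x] are lower bounds
   of [f x] on [Ystar g x]; letting [sigma] tend to 0, so is the value at any
   point of [Ystar g x]. Hence [f x] is constant on [Ystar g x]. *)
Lemma f_le_Ystar x y y' : Ystar g x y -> Ystar g x y' -> f x y <= f x y'.
Proof.
move=> yY y'Y; rewrite -subr_le0.
apply: (@le0_of_small _ _ (L * (4 * L / mu)) sigmabar) => // s /andP[s0 ssb].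
have [|ys ysm ysd] := @penalized_minimizer_near s x y _ yY; first by rewrite (ltW s0).
(* Add the minimality of [ys] for the penalised function to that of [y'] for [g x]; the values of
   [g] cancel. *)
have h1 : f x ys <= f x y'.
  have := ysm y'; have := y'Y ys; rewrite /penalized => h1 h2.
  have : s * f x ys <= s * f x y' by lra.
  by rewrite ler_pM2l.
have := f_lip x ys y; rewrite ler_norml => /andP[h2 _].
have h3 : enorm (ys - y) <= 4 * L / mu * s.
  by rewrite mulrAC ler_pdivlMr // mulrC; lra.
have := ler_wpM2l Lge0 h3; lra.
Qed.

Lemma hyper_objectiveE x y : Ystar g x y -> hyper_objective f g x = f x y.
Proof.
move=> yY; apply/eqP; rewrite eq_le; apply/andP; split.
  apply: ge_inf; last by exists y.
  by exists (f x y) => _ [y' y'Y <-]; exact: f_le_Ystar.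
apply: lb_le_inf; first by exists (f x y), y.
by move=> _ [y' y'Y <-]; exact: f_le_Ystar.
Qed.

Lemma hyper_objective_is_attained : hyper_objective_attained f g.
Proof.
move=> x; have [[y yY] _ _] := g_PL x.
exists y; split => // [|y' y'Y]; first exact: hyper_objectiveE.
exact: f_le_Ystar.
Qed.

(** The gradient of [g x1] vanishes at [y1], so that of [g x2] there is at most
    [L * enorm (x2 - x1)]. *)
Lemma Ystar_near x1 x2 y1 : Ystar g x1 y1 ->
  exists2 y2, Ystar g x2 y2 & mu * enorm (y2 - y1) <= 4 * (L * enorm (x2 - x1)).
Proof.
move=> y1Y.
have [y2 y2Y H] :=
  PL_error_bound L0 (partial_lipschitz_gradient Lge0 lg x2) y1 mu0 (g_PL x2).
exists y2 => //; apply: le_trans H _; rewrite ler_pM2l //.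
rewrite -[grad _ _]subr0 -(grad_g_Ystar y1Y).
exact: partial_grad_lipschitz Lge0 lg _ _ _.
Qed.

(* [p] is a cluster point of [(y_s - y) / s] as [s] tends to 0, where [y_s]
   minimises [penalized f g s x]; it replaces the pseudo-inverse of the possibly
   singular Hessian in the formula for the hyper-gradient. *)
Lemma multiplier_exists x y : Ystar g x y ->
  exists2 p : 'rV[R]_dy, enorm p <= 4 * (L / mu) &
    p *m drsubmx (hess (joint g) (row_mx x y)) = - grad (f x) y.
Proof.
move=> yY; set D := drsubmx _; set r := 4 * (L / mu).
have r0 : 0 <= r by rewrite mulr_ge0 // divr_ge0 // ltW.
(* [p] minimises the residual [enorm (p *m D + grad (f x) y)] over the ball of radius [r]. The
   scaled displacements [(ys - y) / s] lie in this ball with residual [O(s)], so the minimum is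
   0. *)
have [|p pr pmin] := compact_EVT_min _ (@compact_enorm_ball _ _ 0 r)
    (continuous_subspaceT (@continuous_enorm_affine _ _ _ D (grad (f x) y))).
  by exists 0; rewrite /= subr0 enorm0.
rewrite inE /= subr0 in pr; exists p => //.
apply/eqP; rewrite -addr_eq0; apply/eqP/enorm_eq0/eqP.
rewrite eq_le enorm_ge0 andbT.
apply: (@le0_of_small _ _ (L * r ^+ 2 + L * r) sigmabar) => // s /andP[s0 ssb].
have sb : 0 <= s <= sigmabar by rewrite (ltW s0).
have [ys ysm ysd] := penalized_minimizer_near sb yY.
set d := ys - y in ysd.
have dr : enorm d <= r * s.
  by rewrite /r mulrA mulrAC ler_pdivlMr // mulrC; lra.
have d0 := enorm_ge0 d.
apply: (@le_trans _ _ (enorm (s^-1 *: d *m D + grad (f x) y))).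
  apply: pmin; rewrite inE /= subr0 enormZ ger0_norm ?invr_ge0 ?(ltW s0) //.
  by rewrite mulrC ler_pdivrMr.
rewrite -(ler_pM2l s0) -{1}(gtr0_norm s0) -enormZ scalerDr scalemxAl scalerA.
rewrite divff ?gt_eqF // scale1r.
have gs : s *: grad (f x) ys + grad (g x) ys = 0.
  have [lp <-] := penalized_lipschitz_gradient x (ltW s0).
  by apply: grad_argmin lp _ ysm; rewrite ltr_wpDl // mulr_ge0 // ltW.
(* Stationarity of [ys] trades [grad (g x) ys] for [- (s *: grad (f x) ys)], leaving a Taylor error
   of [grad (g x)] and the variation of [grad (f x)]. *)
have -> : d *m D + s *: grad (f x) y =
    - (grad (g x) ys - grad (g x) y - d *m D) -
    s *: (grad (f x) ys - grad (f x) y).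
  have -> : grad (g x) ys = - (s *: grad (f x) ys).
    by apply/eqP; rewrite -addr_eq0 addrC gs.
  rewrite (grad_g_Ystar yY) subr0 scalerBr !opprD !opprK addrA.
  by rewrite [s *: _ + _]addrC addrK.
apply: le_trans (ler_enormD _ _) _; rewrite !enormN enormZ (gtr0_norm s0).
have h1 : enorm (grad (g x) ys - grad (g x) y - d *m D) <= L * enorm d ^+ 2.
  have := hessian_taylor Lge0 ddg lH (row_mx x y) (row_mx 0 d).
  rewrite enorm_row_0mx add_row_mx addr0 [y + d]addrC subrK.
  apply: le_trans; apply: le_trans (enorm_rsubmx_le _).
  have [_ ->] := partial_grad Lge0 lg x y; have [_ ->] := partial_grad Lge0 lg x ys.
  rewrite !linearB /= -[hess _ _]submxK mul_row_block row_mxKr mul0mx add0r.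
  by [].
have h2 : enorm (grad (f x) ys - grad (f x) y) <= L * enorm d.
  by have [_] := partial_lipschitz_gradient Lge0 lf x; apply.
have h3 : enorm d ^+ 2 <= (r * s) ^+ 2 by rewrite ler_pXn2r ?nnegrE // mulr_ge0 // ltW.
have h4 := ler_wpM2l Lge0 h3.
have h5 := ler_wpM2l (ltW s0) h2.
have h6 := ler_wpM2l (mulr_ge0 (ltW s0) Lge0) dr.
apply: le_trans (lerD h1 h5) _; lra.
Qed.

Lemma hyper_objective_expansion x1 : 1 <= L / mu ->
  exists P, forall x2,
    `|hyper_objective f g x2 - hyper_objective f g x1 - dot P (x2 - x1)| <=
    125 * L * (L / mu) ^+ 3 * enorm (x2 - x1) ^+ 2.
Proof.
move=> k1; set k := L / mu in k1 *.
have k0 : 0 <= k by lra.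
have [[y1 y1Y] _ _] := g_PL x1.
have [p pk pD] := multiplier_exists y1Y; rewrite -/k in pk.
pose z1 := row_mx x1 y1; pose H := hess (joint g) z1.
(* The hyper-gradient is [f_x + p g_yx], with [p] in place of [- f_y] times the inverse of
   [g_yy]. *)
exists (lsubmx (grad (joint f) z1) + p *m dlsubmx H) => x2.
have [y2 y2Y dy2] := @Ystar_near x1 x2 y1 y1Y.
rewrite (hyper_objectiveE y1Y) (hyper_objectiveE y2Y).
set u := x2 - x1 in dy2 *; pose v := y2 - y1; rewrite -/v in dy2.
pose D := row_mx u v.
have u0 := enorm_ge0 u.
have z2E : z1 + D = row_mx x2 y2.
  by rewrite add_row_mx /u /v [x1 + _]addrC [y1 + _]addrC !subrK.
have vk : enorm v <= 4 * (k * enorm u).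
  by rewrite /k mulrAC mulrA ler_pdivlMr // mulrC.
have Dk : enorm D <= 5 * (k * enorm u).
  apply: le_trans (enorm_row_mx_le _ _) _; have := ler_wpM2r u0 k1; lra.
have D2 : enorm D ^+ 2 <= 25 * (k * enorm u) ^+ 2.
  have -> : 25 * (k * enorm u) ^+ 2 = (5 * (k * enorm u)) ^+ 2 by ring.
  have ku : 0 <= 5 * (k * enorm u) by exact: mulr_ge0 (ler0n R 5) (mulr_ge0 k0 u0).
  by rewrite ler_pXn2r ?nnegrE ?enorm_ge0.
have T1 := gradient_taylor z1 D Lge0 lf.
rewrite z2E !joint_row_mx -{1}(hsubmxK (grad _ _)) dot_row_mx in T1.
have [_ gf] := partial_grad Lge0 lf x1 y1; rewrite -/z1 in gf.
rewrite -gf in T1.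
have T2 := hessian_taylor Lge0 ddg lH z1 D; rewrite z2E -/H in T2.
have [_ gg1] := partial_grad Lge0 lg x1 y1.
have [_ gg2] := partial_grad Lge0 lg x2 y2.
(* By symmetry of [H] the left side is the pairing of [D *m H] with [row_mx 0 p]. The [y]-parts of
   both gradients of [g] vanish, so only the Taylor error [T2] remains. *)
have C : `|dot (p *m dlsubmx H) u + dot (p *m drsubmx H) v| <=
    L * enorm D ^+ 2 * enorm p.
  rewrite -dot_row_mx -/D.
  have -> : row_mx (p *m dlsubmx H) (p *m drsubmx H) = row_mx 0 p *m H.
    by rewrite -{3}[H]submxK mul_row_block !mul0mx !add0r.
  rewrite (hessian_symmetric Lge0 lg.1 ddg lH) -/H.
  have -> : dot (D *m H) (row_mx 0 p) =
      - dot (grad (joint g) (row_mx x2 y2) - grad (joint g) z1 - D *m H)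
          (row_mx 0 p).
    rewrite !dotBl.
    rewrite -(hsubmxK (grad _ (row_mx x2 y2))) -(hsubmxK (grad _ z1)).
    rewrite !dot_row_mx -gg1 -gg2 (grad_g_Ystar y1Y) (grad_g_Ystar y2Y).
    by rewrite !linear0 ![dot 0 _]dotC !linear0 subrr sub0r opprK.
  rewrite normrN; apply: le_trans (abs_dot_le _ _) _.
  by rewrite enorm_row_0mx ler_wpM2r ?enorm_ge0.
rewrite pD dotNl in C.
set A := f x2 y2 - f x1 y1 in T1 *.
have -> : A - dot (lsubmx (grad (joint f) z1) + p *m dlsubmx H) u =
    (A - (dot (lsubmx (grad (joint f) z1)) u + dot (grad (f x1) y1) v)) -
    (dot (p *m dlsubmx H) u - dot (grad (f x1) y1) v) by rewrite dotDl; ring.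
apply: le_trans (ler_normB _ _) _; apply: le_trans (lerD T1 C) _.
have -> : L * enorm D ^+ 2 + L * enorm D ^+ 2 * enorm p =
    L * enorm D ^+ 2 * (1 + enorm p) by ring.
(* 25 comes from [D2], and 5 from [1 + enorm p <= 1 + 4 * k <= 5 * k], as [1 <= k]. *)
have -> : 125 * L * k ^+ 3 * enorm u ^+ 2 =
    L * (25 * (k * enorm u) ^+ 2) * (5 * k) by ring.
apply: ler_pM; rewrite ?mulr_ge0 ?sqr_ge0 ?addr_ge0 ?enorm_ge0 //.
  by rewrite ler_wpM2l.
by lra.
Qed.

End HyperObjective.

Theorem lemma4p4 (R : realType) :
  exists2 C : R, 0 < C &
  forall (dx dy : nat) (f g : 'rV[R]_dx -> 'rV[R]_dy -> R)
    (sigmabar mu C_f L_f L_g rho_f rho_g : R),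
  standing_assumption f g sigmabar mu C_f L_f L_g rho_f rho_g ->
  let ell := Num.max (Num.max (Num.max C_f L_f) L_g) rho_g in
  let kappa := ell / mu in
  1 <= kappa ->
  hyper_objective_attained f g /\
  lipschitz_gradient (C * ell * kappa ^+ 3) (hyper_objective f g).
Proof.
(* 750 is 6 times 125: the expansion has constant 125, and passing to the gradient costs 6. *)
exists 750 => // dx dy f g sigmabar mu C_f L_f L_g rho_f rho_g.
case=> sb0 mu0 Cf0 Lf0 Lg0 _ rg0 PL f_lip lf lg _ _ _ _ ddg lH ell kappa k1.
have CfL : C_f <= ell by rewrite !le_max lexx.
have LfL : L_f <= ell by rewrite !le_max lexx orbT.
have LgL : L_g <= ell by rewrite !le_max lexx !orbT.
have rgL : rho_g <= ell by rewrite !le_max lexx !orbT.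
have L0 : 0 < ell by exact: lt_le_trans CfL.
have f_lip' x y1 y2 : `|f x y1 - f x y2| <= ell * enorm (y1 - y2).
  by apply: le_trans (f_lip _ _ _) _; rewrite ler_wpM2r ?enorm_ge0.
have lf' : lipschitz_gradient ell (joint f).
  case: lf => d l; split=> // z1 z2.
  by apply: le_trans (l _ _) _; rewrite ler_wpM2r ?enorm_ge0.
have lg' : lipschitz_gradient ell (joint g).
  case: lg => d l; split=> // z1 z2.
  by apply: le_trans (l _ _) _; rewrite ler_wpM2r ?enorm_ge0.
have lH' z1 z2 : opnorm (hess (joint g) z1 - hess (joint g) z2) <=
    ell * enorm (z1 - z2).
  rewrite -(hsubmxK z1) -(hsubmxK z2); apply: le_trans (lH _ _ _ _) _.
  by rewrite opp_row_mx add_row_mx ler_wpM2r ?enorm_ge0.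
split; first exact: hyper_objective_is_attained sb0 mu0 L0 PL f_lip' lf' lg'.
have [P HP] : {P : 'rV[R]_dx -> 'rV[R]_dx | forall x1 x2,
    `|hyper_objective f g x2 - hyper_objective f g x1 - dot (P x1) (x2 - x1)| <=
    125 * ell * kappa ^+ 3 * enorm (x2 - x1) ^+ 2}.
  have := fun x1 => cid (hyper_objective_expansion sb0 mu0 L0 PL f_lip' lf' lg'
    ddg lH' x1 k1).
  by move=> H; exists (fun x => sval (H x)) => x1; exact: (svalP (H x1)).
have -> : 750 * ell * kappa ^+ 3 = 6 * (125 * ell * kappa ^+ 3) by ring.
apply: quadratic_expansion_lipschitz_gradient HP.
have k0 : 0 <= kappa := le_trans ler01 k1.
exact: mulr_ge0 (mulr_ge0 (ler0n R 125) (ltW L0)) (exprn_ge0 _ k0).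
Qed.
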